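(* Let $K$ be a field, $B \in K^{n\times n}$, and let $B_0, B_1, \ldots, B_{n-1} \in K^{n\times n}$ be the matrices determined by $$\mathrm{adj}(\lambda I - B) = \lambda^{n-1}B_0 + \lambda^{n-2}B_1 + \ldots + \lambda B_{n-2} + B_{n-1}.$$ Then for every column $\vec{v} = [v_1\ \ldots\ v_n]^T \in K^{n\times 1}$ and every $0\le k<n$, $$B_k\vec{v} = (-1)^k \begin{bmatrix} \delta_{k+1}^1(B; v_1,\ldots,v_n) \\ \delta_{k+1}^2(B; v_1,\ldots,v_n)\\ \vdots \\ \delta_{k+1}^n(B; v_1,\ldots,v_n)\end{bmatrix}.$$
   Context: $\mathrm{adj}$ denotes the adjoint (adjugate) matrix, so $(\lambda I - B)\,\mathrm{adj}(\lambda I - B) = \det(\lambda I - B) I$. For a square matrix $M\in K^{n\times n}$ and $1\le i,k\le n$, $\delta_k^i(M)$ denotes the sum of the principal minors of $M$ of order $k$ containing the $i$th column. $B^i(v_1,\ldots,v_n)\in K^{n\times n}$ is the matrix obtained from $B$ by substituting $[v_1\ \ldots\ v_n]^T$ in place of the $i$th column, and $\delta_k^i(B; v_1,\ldots,v_n) = \delta_k^i\big(B^i(v_1,\ldots,v_n)\big)$. *)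

(* Defs.v *)
From mathcomp Require Import all_boot all_order all_algebra.

Set Implicit Arguments.
Unset Strict Implicit.
Unset Printing Implicit Defensive.

Import GRing.Theory.
Local Open Scope ring_scope.

(* [enum_val] enumerates S in increasing order, so this is the determinant of
   the submatrix of M with rows and columns in S, in their original order. *)
Definition principal_minor (K : fieldType) (n : nat) (M : 'M[K]_n)
    (S : {set 'I_n}) : K :=
  \det (mxsub (@enum_val _ (mem S)) (@enum_val _ (mem S)) M).

Definition delta (K : fieldType) (n : nat) (k : nat) (i : 'I_n)
    (M : 'M[K]_n) : K :=
  \sum_(S : {set 'I_n} | (#|S| == k) && (i \in S)) principal_minor M S.

Definition subst_col (K : fieldType) (n : nat) (B : 'M[K]_n) (i : 'I_n)
    (v : 'cV[K]_n) : 'M[K]_n :=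
  \matrix_(r < n, c < n) (if c == i then v r 0 else B r c).

Definition delta_subst (K : fieldType) (n : nat) (k : nat) (i : 'I_n)
    (B : 'M[K]_n) (v : 'cV[K]_n) : K :=
  delta k i (subst_col B i v).

(* Main.v *)
Require Import Defs.
From mathcomp Require Import all_boot all_order all_algebra.
From mathcomp Require Import perm.

Set Implicit Arguments.
Unset Strict Implicit.
Unset Printing Implicit Defensive.

Import GRing.Theory.
Local Open Scope ring_scope.

(** By Cramer's rule, the [i]-th entry of [adj(A) v] is the determinant of [A]
    with [v] put in place of its [i]-th column ([mul_adj_subst_col]).  For
    [A = X I - B] this substituted matrix is [D + C], where [D] is diagonal
    with entry [0] at [i] and [X] elsewhere, and [C] is [-B] with [i]-th column
    [v].  Expanding the determinant of a sum with a diagonal matrix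
    ([det_diag_add]) gives the sum, over all sets [S] of indices, of the
    principal minor of [C] on [S] times the product of the diagonal entries of
    [D] outside [S].  The zero of [D] kills the sets that miss [i]; any other
    [S] contributes its minor times [X^(n - #|S|)].  Restoring the sign of
    the [#|S| - 1] columns of [-B] turns that minor into
    [(-1)^(#|S| - 1)] times the one of [B] with [i]-th column [v]
    ([principal_minor_subst_opp]), and the theorem is the comparison of the
    coefficients of [X^(n - 1 - k)], to which exactly the sets of cardinal
    [k + 1] contribute. *)

(** Relabelling rows and columns alike multiplies the determinant twice by the
    sign of the same permutation; allowing [m] and [n] to differ
    syntactically avoids casts when the indices are split into blocks. *)
Lemma det_mxsub_bij (R : comPzRingType) m n (f : 'I_m -> 'I_n) (A : 'M[R]_n) :
  bijective f -> \det (mxsub f f A) = \det A.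
Proof.
move=> bij_f; have eq_mn: m = n by have := bij_eq_card bij_f; rewrite !card_ord.
subst m; pose s := perm (bij_inj bij_f).
have ->: mxsub f f A = row_perm s (col_perm s A).
  by apply/matrixP=> i j; rewrite !mxE !permE.
by rewrite row_permE col_permE !det_mulmx !det_perm odd_permV mulrCA
  -signr_addb addbb mulr1.
Qed.

(** Listing [S] before its complement makes the matrix block upper triangular,
    with a diagonal lower right block. *)
Lemma det_diag_rows (R : comPzRingType) n (d : 'rV[R]_n) (S : {set 'I_n})
    (A : 'M[R]_n) :
  (forall i j, i \notin S -> A i j = d 0 i *+ (i == j)) ->
  \det A = (\prod_(j in ~: S) d 0 j)
           * \det (mxsub (@enum_val _ (mem S)) (@enum_val _ (mem S)) A).
Proof.
move=> diagA.
pose f (x : 'I_(#|S| + #|~: S|)) : 'I_n :=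
  match split x with inl a => enum_val a | inr b => enum_val b end.
have fl a : f (lshift _ a) = enum_val a by rewrite /f (unsplitK (inl _ a)).
have fr b : f (rshift _ b) = enum_val b by rewrite /f (unsplitK (inr _ b)).
have notS (b : 'I_#|~: S|) : enum_val b \notin S.
  by have := enum_valP b; rewrite inE.
have neq (a : 'I_#|S|) (b : 'I_#|~: S|) : enum_val b != enum_val a.
  by apply: contraNneq (notS b) => ->; apply: enum_valP.
have inj_f : injective f.
  move=> x y; case: (split_ordP x) => a ->; case: (split_ordP y) => b ->;
    rewrite ?fl ?fr.
  - by move/enum_val_inj->.
  - by move/esym/eqP; rewrite (negPf (neq _ _)).
  - by move/eqP; rewrite (negPf (neq _ _)).
  - by move/enum_val_inj->.
have bij_f : bijective f.
  by apply: inj_card_bij; rewrite // !card_ord cardsC card_ord.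
rewrite -(det_mxsub_bij A bij_f) -[mxsub f f A]submxK.
have ->: dlsubmx (mxsub f f A) = 0.
  apply/matrixP=> b a; rewrite !mxE fl fr diagA ?notS //.
  by rewrite (negPf (neq _ _)).
have ->: drsubmx (mxsub f f A)
         = diag_mx (\row_(b < #|~: S|) d 0 (enum_val b)).
  apply/matrixP=> b c; rewrite !mxE !fr diagA ?notS //.
  by rewrite (inj_eq enum_val_inj).
rewrite det_ublock det_diag mulrC; congr (_ * _).
  by rewrite [RHS]big_enum_val; apply: eq_bigr => b _; rewrite mxE.
by congr (\det _); apply/matrixP=> a b; rewrite !mxE !fl.
Qed.

(** By multilinearity in the rows, the determinant is a sum over the set [S]
    of the rows that are taken from [M] rather than from the diagonal. *)
Lemma det_diag_add (R : comPzRingType) n (d : 'rV[R]_n) (M : 'M[R]_n) :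
  \det (diag_mx d + M) =
  \sum_(S : {set 'I_n}) (\prod_(j in ~: S) d 0 j)
     * \det (mxsub (@enum_val _ (mem S)) (@enum_val _ (mem S)) M).
Proof.
pose A (S : {set 'I_n}) : 'M[R]_n :=
  \matrix_(i, j) (if i \in S then M i j else diag_mx d i j).
transitivity (\sum_(S : {set 'I_n}) \det (A S)).
  rewrite exchange_big; apply: eq_bigr => s _ /=; rewrite -mulr_sumr.
  congr (_ * _); under eq_bigr do rewrite mxE addrC.
  rewrite bigA_distr; apply: eq_big => [S | S _]; first by rewrite ?inE.
  by apply: eq_bigr => i _ /=; rewrite [in RHS]mxE.
apply: eq_bigr => S _; rewrite (@det_diag_rows _ _ d S) => [|i j iS].
  congr (_ * _); congr (\det _); apply/matrixP=> a b; rewrite !mxE.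
  by rewrite (enum_valP a).
by rewrite !mxE (negPf iS).
Qed.

(** The cofactors along column [i] do not see the entries of that column. *)
Lemma mul_adj_subst_col (R : comPzRingType) n (A A' : 'M[R]_n) (i : 'I_n) :
  col' i A' = col' i A -> (\adj A *m col i A') i 0 = \det A'.
Proof.
move=> eqA; rewrite mxE (expand_det_col A' i); apply: eq_bigr => r _.
by rewrite !mxE mulrC /cofactor eqA.
Qed.

(** Negating [B] negates every column of the submatrix on [S] except the one
    that holds [v], hence the exponent [#|S|.-1]. *)
Lemma principal_minor_subst_opp (K : fieldType) n (B : 'M[K]_n) (i : 'I_n)
    (v : 'cV[K]_n) (S : {set 'I_n}) :
  i \in S ->
  principal_minor (subst_col (- B) i v) S
  = (-1) ^+ #|S|.-1 * principal_minor (subst_col B i v) S.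
Proof.
move=> iS; pose e (j : 'I_n) : K := if j == i then 1 else -1.
rewrite /principal_minor.
have ->: mxsub (@enum_val _ (mem S)) (@enum_val _ (mem S))
           (subst_col (- B) i v)
         = mxsub (@enum_val _ (mem S)) (@enum_val _ (mem S)) (subst_col B i v)
           *m diag_mx (\row_(b < #|S|) e (enum_val b)).
  rewrite mul_mx_diag; apply/matrixP=> a b; rewrite !mxE /e.
  by case: eqP; rewrite ?mulr1 ?mulrN1.
rewrite det_mulmx det_diag mulrC; congr (_ * _).
under eq_bigr do rewrite mxE.
rewrite -(big_enum_val e) (big_setD1 i) //= /e eqxx mul1r.
rewrite (eq_bigr (fun=> -1)) => [|j]; last first.
  by rewrite !inE => /andP[/negPf->].
by rewrite prodr_const (cardsD1 i S) iS.
Qed.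

(** This is Cramer's rule read through [det_diag_add]: the generating
    polynomial whose coefficients the theorem compares. *)
Lemma adj_char_poly_mx_mul (K : fieldType) n (B : 'M[K]_n) (v : 'cV[K]_n)
    (i : 'I_n) :
  (\adj ('X%:M - map_mx polyC B) *m map_mx polyC v) i 0
  = \sum_(S : {set 'I_n} | i \in S)
      ((-1) ^+ #|S|.-1 * principal_minor (subst_col B i v) S) *: 'X^(n - #|S|).
Proof.
pose d : 'rV[{poly K}]_n := \row_j (if j == i then 0 else 'X).
pose C := subst_col (- B) i v.
have colC : map_mx polyC v = col i (diag_mx d + map_mx polyC C).
  apply/matrixP=> r c; rewrite ord1 !mxE eqxx.
  by case: eqP => [->|_]; rewrite ?eqxx ?mul0rn ?add0r.
(* Both [X I - B] and [D + C] have the same columns other than the [i]-th. *)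
rewrite {}colC mul_adj_subst_col; last first.
  apply/matrixP=> r c; have ne_ci : (lift i c == i) = false.
    by rewrite eq_sym (negPf (neq_lift _ _)).
  rewrite !mxE ne_ci polyCN.
  by have [->|] := eqVneq r (lift i c); rewrite ?ne_ci ?mulr0n.
rewrite det_diag_add (bigID (fun S : {set 'I_n} => i \in S)) /=.
(* A set that misses [i] has the zero diagonal entry [d 0 i] as a factor. *)
rewrite [X in _ + X]big1 ?addr0 => [|S iS]; last first.
  by rewrite (big_setD1 i) ?inE //= mxE eqxx !mul0r.
apply: eq_bigr => S iS.
rewrite -map_mxsub det_map_mx mulrC mul_polyC -principal_minor_subst_opp //.
congr (_ *: _); rewrite (eq_bigr (fun=> 'X)) => [|j].
  by rewrite prodr_const cardsCs setCK card_ord.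
by rewrite inE mxE => jS; case: eqP jS => // ->; rewrite iS.
Qed.

Theorem theorem3p3 (K : fieldType) (n : nat) (B : 'M[K]_n)
    (Bs : 'I_n -> 'M[K]_n)
    (hBs : \adj ('X%:M - map_mx polyC B)
           = \sum_(k < n) 'X^(n - 1 - k) *: map_mx polyC (Bs k)) :
  forall (v : 'cV[K]_n) (k : 'I_n),
    Bs k *m v = (-1) ^+ k *: \col_(i < n) delta_subst k.+1 i B v.
Proof.
move=> v k; apply/matrixP=> i j; rewrite {j}ord1.
have /(congr1 (fun p : {poly K} => p`_(n - 1 - k))) :=
  adj_char_poly_mx_mul B v i.
rewrite {}hBs mulmx_suml summxE !coef_sum => eq_coef.
transitivity (\sum_(l < n)
    ((('X^(n - 1 - l) *: map_mx polyC (Bs l)) *m map_mx polyC v) i 0)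
      `_(n - 1 - k)).
  rewrite (bigD1 k) //= big1 ?addr0 => [|l neq_lk].
    by rewrite -scalemxAl -map_mxM !mxE coefMC coefXn eqxx mul1r.
  rewrite -scalemxAl -map_mxM !mxE coefMC coefXn.
  rewrite (_ : _ == _ = false) ?mul0r //.
  (* Truncated subtraction from [n - 1] is injective on indices below [n]. *)
  apply: contraNF neq_lk => /eqP eq_kl; apply/eqP/val_inj => /=.
  have lt_k := ltn_ord k; have lt_l := ltn_ord l.
  have le_pred (m : 'I_n) : (m <= n - 1)%N.
    by rewrite subn1 -ltnS (ltn_predK lt_k).
  by rewrite -(subKn (le_pred l)) -eq_kl subKn.
rewrite {}eq_coef !mxE /delta_subst /delta mulr_sumr.
rewrite (bigID (fun S : {set 'I_n} => #|S| == k.+1)) /=.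
rewrite [X in _ + X]big1 ?addr0 => [|S /andP[iS cardS]]; last first.
  rewrite coefZ coefXn (_ : _ == _ = false) ?mulr0 //.
  apply: contraNF cardS => /eqP eq_sub; apply/eqP.
  have leS : (#|S| <= n)%N by rewrite -[X in (_ <= X)%N]card_ord max_card.
  by rewrite -(subKn leS) -eq_sub -subnDA add1n subKn.
apply: eq_big => [S | S /andP[_ /eqP cardS]]; first by rewrite andbC.
by rewrite coefZ coefXn cardS -subnDA add1n eqxx mulr1.
Qed.
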